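(* Let $\Omega$ be a compact Hausdorff space, let $E$ and $F$ be Banach spaces, and let $T: C(\Omega,E)\to F$ be a nuclear operator. Then the induced operator $T^\#$ on $C(\Omega)$, defined by $T^\#(f)(e)=T(f\otimes e)$ for $f\in C(\Omega)$ and $e\in E$, takes its values in the space $\mathcal N(E,F)$ of nuclear operators from $E$ to $F$.
   Context: Banach spaces are over $\mathbb R$ or $\mathbb C$. $C(\Omega,E)$ is the Banach space of continuous $E$-valued functions on $\Omega$ with the supremum norm, and $C(\Omega)$ is the space of continuous scalar-valued functions on $\Omega$. For $f\in C(\Omega)$ and $e\in E$, $f\otimes e\in C(\Omega,E)$ is given by $(f\otimes e)(\omega)=f(\omega)e$. $\mathcal L(X,Y)$ is the space of bounded linear operators from $X$ to $Y$. Every bounded linear $T: C(\Omega,E)\to F$ induces in this way a bounded linear operator $T^\#: C(\Omega)\to\mathcal L(E,F)$. Nuclear operators: $S\in\mathcal L(X,Y)$ is nuclear if there are sequences $(x_n^* )$ in $X^*$ and $(y_n)$ in $Y$ with $\sum_{n=1}^\infty \|x_n^*\|\,\|y_n\|<\infty$ and $S(x)=\sum_{n=1}^\infty x_n^*(x)y_n$ for all $x\in X$. *)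

(* Defs.v *)
From HB Require Import structures.
From mathcomp Require Import all_boot all_order all_algebra.
From mathcomp Require Import all_classical all_reals all_analysis.
From mathcomp Require Import complex.
Set Implicit Arguments.
Unset Strict Implicit.
Unset Printing Implicit Defensive.
Import Order.TTheory GRing.Theory Num.Theory.
Import numFieldNormedType.Exports.
Local Open Scope classical_set_scope.
Local Open Scope ring_scope.

Variant scalar_kind := RealScalars | ComplexScalars.

Definition scalars (R : realType) (k : scalar_kind) : numFieldType :=
  match k with
  | RealScalars => R : numFieldType
  | ComplexScalars => R[i] : numFieldType
  end.

(* Norms of a [normedModType K] take their values in [K]; for the complex
   scalars the order of [K] is the partial order of [R[i]], in which a nonempty
   bounded set of nonnegative elements has its usual supremum. *)
Lemma supremumsP (R : realType) (k : scalar_kind) (A : set (scalars R k)) :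
  A !=set0 -> (forall x, A x -> 0 <= x) -> has_ubound A ->
  supremums A (supremum 0 A).
Proof.
move=> A0 Age0 Aub; rewrite /supremum; case: ifPn => [/eqP A_0|_].
  by case: A0 => x; rewrite A_0.
suff [s As] : supremums A !=set0 by case: xgetP => [_ -> //|/(_ s)].
case: k A A0 Age0 Aub => /= A [a Aa] Age0 [M MA].
  exists (sup A); split => [x Ax|x ubx].
    by apply: ub_le_sup => //; exists M.
  by apply: ge_sup => //; exists a.
pose B := [set complex.Re x | x in A].
have Im0 x : A x -> complex.Im x = 0.
  by move=> /Age0; rewrite lecE => /andP[/eqP -> _].
have B0 : B !=set0 by exists (complex.Re a); exists a.
exists ((sup B)%:C)%C; split => [x Ax|x ubx].
- rewrite lecE /= Im0 // eqxx /=; apply: ub_le_sup; last by exists x.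
  by exists (complex.Re M) => _ [y Ay <-]; move: (MA _ Ay); rewrite lecE => /andP[].
- have := ubx _ Aa; rewrite !lecE /= (Im0 a) // => /andP[-> _] /=.
  apply: ge_sup => // _ [y Ay <-].
  by move: (ubx _ Ay); rewrite lecE => /andP[].
Qed.

Lemma le_supremum (R : realType) (k : scalar_kind) (A : set (scalars R k)) x :
  (forall x, A x -> 0 <= x) -> has_ubound A -> A x -> x <= supremum 0 A.
Proof. by move=> A0 Aub Ax; case: (supremumsP _ A0 Aub) => [|+ _]; [exists x|exact]. Qed.

Lemma supremum_le (R : realType) (k : scalar_kind) (A : set (scalars R k)) M :
  0 <= M -> (forall x, A x -> 0 <= x) -> ubound A M -> supremum 0 A <= M.
Proof.
move=> M0 A0 AM; have [->|/set0P An] := eqVneq A set0; first by rewrite supremum0.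
by case: (supremumsP An A0 (ex_intro _ M AM)) => _; exact.
Qed.

(* The compactness proof is a parameter of the type, so that the supremum norm
   can be attached to it as a canonical structure. *)
Record cfun (Omega : topologicalType) (cOmega : compact [set: Omega])
    (E : topologicalType) := CFun {
  cfun_apply :> Omega -> E;
  cfun_continuous : continuous cfun_apply
}.

Section cfun_lmodule.
Context (K : numFieldType) (Omega : topologicalType).
Context (cOmega : compact [set: Omega]) (E : normedModType K).
Local Notation C := (cfun cOmega E).

HB.instance Definition _ := gen_eqMixin C.
HB.instance Definition _ := gen_choiceMixin C.

Lemma cfunP (f g : C) : f =1 g -> f = g.
Proof.
case: f g => [f cf] [g cg] /= /funext fg; subst g.
by congr CFun; exact: Prop_irrelevance.
Qed.

Let cfun_zero_cts : continuous (fun _ : Omega => 0 : E).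
Proof. by move=> x; exact: cvg_cst. Qed.
Let cfun_add_cts (f g : C) : continuous (fun w => f w + g w).
Proof. by move=> x; apply: cvgD; exact: cfun_continuous. Qed.
Let cfun_opp_cts (f : C) : continuous (fun w => - f w).
Proof. by move=> x; apply: cvgN; exact: cfun_continuous. Qed.
Let cfun_scale_cts (a : K) (f : C) : continuous (fun w => a *: f w).
Proof. by move=> x; apply: cvgZl_tmp; exact: cfun_continuous. Qed.

Let zero := CFun cOmega cfun_zero_cts.
Let add f g := CFun cOmega (@cfun_add_cts f g).
Let opp f := CFun cOmega (@cfun_opp_cts f).
Let scale a f := CFun cOmega (@cfun_scale_cts a f).

Let addA : associative add.
Proof. by move=> f g h; apply: cfunP => w; exact: addrA. Qed.
Let addC : commutative add.
Proof. by move=> f g; apply: cfunP => w; exact: addrC. Qed.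
Let add0 : left_id zero add.
Proof. by move=> f; apply: cfunP => w; exact: add0r. Qed.
Let addN : left_inverse zero opp add.
Proof. by move=> f; apply: cfunP => w; exact: addNr. Qed.

HB.instance Definition _ := GRing.isZmodule.Build C addA addC add0 addN.

Let scaleA a b f : scale a (scale b f) = scale (a * b) f.
Proof. by apply: cfunP => w; exact: scalerA. Qed.
Let scale1 : left_id 1 scale.
Proof. by move=> f; apply: cfunP => w; exact: scale1r. Qed.
Let scaleDr : right_distributive scale +%R.
Proof. by move=> a f g; apply: cfunP => w; exact: scalerDr. Qed.
Let scaleDl f : {morph scale^~ f : a b / a + b}.
Proof. by move=> a b; apply: cfunP => w; exact: scalerDl. Qed.

HB.instance Definition _ :=
  GRing.Zmodule_isLmodule.Build K C scaleA scale1 scaleDr scaleDl.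

Lemma cfun0E w : (0 : C) w = 0. Proof. by []. Qed.
Lemma cfunDE (f g : C) w : (f + g) w = f w + g w. Proof. by []. Qed.
Lemma cfunZE a (f : C) w : (a *: f) w = a *: f w. Proof. by []. Qed.

Lemma cfun_bounded (f : C) : has_ubound [set `|f w| | w in [set: Omega]].
Proof.
have /(compact_near_coveringP _) := cOmega.
move=> /(_ K +oo (fun M w => `|f w| <= M)) /= [w _|M [_ fM]].
  near=> x M => /=; apply: (@le_trans _ _ (`|f w| + 1)).
    by near: x; apply: cvgr_norm_le; [exact: cfun_continuous|rewrite ltrDl].
  by near: M; exact: nbhs_pinfty_ge.
have Mlt : M < M + 1 by rewrite ltrDl.
by exists (M + 1) => _ [w _ <-]; exact: fM.
Unshelve. all: by end_near. Qed.

End cfun_lmodule.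

Section cfun_normed.
Context (R : realType) (k : scalar_kind) (Omega : topologicalType).
Context (cOmega : compact [set: Omega]) (E : normedModType (scalars R k)).
Local Notation K := (scalars R k).
Local Notation C := (cfun cOmega E).

(* When Omega is empty this is the norm of the zero space. *)
Definition sup_norm (f : C) : K := supremum 0 [set `|f w| | w in [set: Omega]].

Lemma ler_sup_norm (f : C) w : `|f w| <= sup_norm f.
Proof.
by apply: le_supremum; [move=> _ [? _ <-]|exact: cfun_bounded|exists w].
Qed.

Lemma sup_norm_ler (f : C) M : 0 <= M -> (forall w, `|f w| <= M) -> sup_norm f <= M.
Proof.
by move=> M0 fM; apply: supremum_le => // [_ [? _ <-]|_ [w _ <-]].
Qed.

Lemma sup_norm_ge0 (f : C) : 0 <= sup_norm f.
Proof.
have [/set0P[_ [w _ _]]|] := boolP ([set `|f w| | w in [set: Omega]] != set0).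
  exact: le_trans (ler_sup_norm f w).
by rewrite negbK /sup_norm => /eqP ->; rewrite supremum0.
Qed.

Let sup_normD (f g : C) : sup_norm (f + g) <= sup_norm f + sup_norm g.
Proof.
apply: sup_norm_ler => [|w]; first by rewrite addr_ge0 ?sup_norm_ge0.
by rewrite cfunDE (le_trans (ler_normD _ _))// lerD ?ler_sup_norm.
Qed.

Let sup_normZ (a : K) (f : C) : sup_norm (a *: f) = `|a| * sup_norm f.
Proof.
have sZ b (g : C) : sup_norm (b *: g) <= `|b| * sup_norm g.
  apply: sup_norm_ler => [|w]; first by rewrite mulr_ge0 ?sup_norm_ge0.
  by rewrite cfunZE normrZ ler_wpM2l ?ler_sup_norm.
apply/eqP; rewrite eq_le sZ /=; have [->|a0] := eqVneq a 0.
  by rewrite normr0 mul0r sup_norm_ge0.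
rewrite mulrC -ler_pdivlMr ?normr_gt0// mulrC -normfV.
by rewrite -{1}[f](scalerK a0); exact: sZ.
Qed.

Let sup_norm0_eq0 (f : C) : sup_norm f = 0 -> f = 0.
Proof.
move=> f0; apply: cfunP => w; apply/eqP; rewrite cfun0E -normr_le0 -f0.
exact: ler_sup_norm.
Qed.

HB.instance Definition _ :=
  Lmodule_isNormed.Build K C sup_normD sup_normZ sup_norm0_eq0.

Lemma cfun_normE (f : C) : `|f| = sup_norm f. Proof. by []. Qed.

Lemma ler_cfun_norm (f : C) w : `|f w| <= `|f|.
Proof. exact: ler_sup_norm. Qed.

End cfun_normed.

Record bounded_operator (K : numFieldType) (X Y : normedModType K) := BoundedOperator {
  bop_apply :> X -> Y;
  bop_linear : linear bop_apply;
  bop_bounded : exists M : K, forall x, `|bop_apply x| <= M * `|x|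
}.

Section bop_lmodule.
Context (K : numFieldType) (X Y : normedModType K).
Local Notation L := (bounded_operator X Y).

HB.instance Definition _ (S : L) :=
  GRing.isLinear.Build K X Y *:%R (bop_apply S) (bop_linear S).

HB.instance Definition _ := gen_eqMixin L.
HB.instance Definition _ := gen_choiceMixin L.

Lemma bopP (S U : L) : S =1 U -> S = U.
Proof.
case: S U => [S lS bS] [U lU bU] /= /funext SU; subst U.
by congr BoundedOperator; exact: Prop_irrelevance.
Qed.

Lemma bop_gt0_bound (S : L) : exists2 M : K, 0 < M & forall x, `|S x| <= M * `|x|.
Proof.
case: (bop_bounded S) => M SM; exists (`|M| + 1) => [|x].
  by rewrite ltr_wpDl.
rewrite -[leLHS]normr_id (le_trans (y := `|M * `|x| |))//.
  rewrite normr_id [leRHS]ger0_norm //.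
  exact: le_trans (SM x).
by rewrite normrM normr_id ler_wpM2r// lerDl.
Qed.

Let zero_linear : linear (fun _ : X => 0 : Y).
Proof. by move=> a x y; rewrite scaler0 addr0. Qed.
Let zero_bounded : exists M : K, forall x : X, `|0 : Y| <= M * `|x|.
Proof. by exists 0 => x; rewrite normr0 mul0r. Qed.
Let add_linear (S U : L) : linear (fun x => S x + U x).
Proof. by move=> a x y; rewrite !linearP scalerDr addrACA. Qed.
Let add_bounded (S U : L) : exists M : K, forall x, `|S x + U x| <= M * `|x|.
Proof.
case: (bop_bounded S) (bop_bounded U) => [M SM] [N UN]; exists (M + N) => x.
by rewrite (le_trans (ler_normD _ _))// mulrDl lerD.
Qed.
Let opp_linear (S : L) : linear (fun x => - S x).
Proof. by move=> a x y; rewrite linearP opprD scalerN. Qed.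
Let opp_bounded (S : L) : exists M : K, forall x, `|- S x| <= M * `|x|.
Proof. by case: (bop_bounded S) => M SM; exists M => x; rewrite normrN. Qed.
Let scale_linear (b : K) (S : L) : linear (fun x => b *: S x).
Proof. by move=> a x y; rewrite linearP scalerDr !scalerA mulrC. Qed.
Let scale_bounded (b : K) (S : L) : exists M : K, forall x, `|b *: S x| <= M * `|x|.
Proof.
case: (bop_bounded S) => M SM; exists (`|b| * M) => x.
by rewrite normrZ -mulrA ler_wpM2l.
Qed.

Let zero := BoundedOperator zero_linear zero_bounded.
Let add S U := BoundedOperator (add_linear S U) (add_bounded S U).
Let opp S := BoundedOperator (opp_linear S) (opp_bounded S).
Let scale a S := BoundedOperator (scale_linear a S) (scale_bounded a S).

Let addA : associative add.
Proof. by move=> f g h; apply: bopP => w; exact: addrA. Qed.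
Let addC : commutative add.
Proof. by move=> f g; apply: bopP => w; exact: addrC. Qed.
Let add0 : left_id zero add.
Proof. by move=> f; apply: bopP => w; exact: add0r. Qed.
Let addN : left_inverse zero opp add.
Proof. by move=> f; apply: bopP => w; exact: addNr. Qed.

HB.instance Definition _ := GRing.isZmodule.Build L addA addC add0 addN.

Let scaleA a b f : scale a (scale b f) = scale (a * b) f.
Proof. by apply: bopP => w; exact: scalerA. Qed.
Let scale1 : left_id 1 scale.
Proof. by move=> f; apply: bopP => w; exact: scale1r. Qed.
Let scaleDr : right_distributive scale +%R.
Proof. by move=> a f g; apply: bopP => w; exact: scalerDr. Qed.
Let scaleDl f : {morph scale^~ f : a b / a + b}.
Proof. by move=> a b; apply: bopP => w; exact: scalerDl. Qed.

HB.instance Definition _ :=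
  GRing.Zmodule_isLmodule.Build K L scaleA scale1 scaleDr scaleDl.

Lemma bop0E x : (0 : L) x = 0. Proof. by []. Qed.
Lemma bopDE (S U : L) x : (S + U) x = S x + U x. Proof. by []. Qed.
Lemma bopZE a (S : L) x : (a *: S) x = a *: S x. Proof. by []. Qed.

End bop_lmodule.

Section bop_normed.
Context (R : realType) (k : scalar_kind) (X Y : normedModType (scalars R k)).
Local Notation K := (scalars R k).
Local Notation L := (bounded_operator X Y).

(* This definition also gives the norm of the dual of X, which is
   [bounded_operator X (scalars R k)^o]. *)
Definition operator_norm (S : L) : K :=
  supremum 0 [set `|S x| | x in [set x : X | `|x| <= 1]].

Lemma operator_norm_ge0 (S : L) : 0 <= operator_norm S.
Proof.
apply: le_supremum => [_ [? _ <-]//||].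
  have [M M0 SM] := bop_gt0_bound S; exists M => _ [x /= x1 <-].
  by rewrite (le_trans (SM x))// ler_piMr// ltW.
by exists 0 => /=; rewrite ?normr0 ?ler01// linear0 normr0.
Qed.

Lemma ler_operator_norm (S : L) x : `|S x| <= operator_norm S * `|x|.
Proof.
have [->|x0] := eqVneq x 0; first by rewrite linear0 !normr0 mulr0.
rewrite -ler_pdivrMr ?normr_gt0// mulrC -(normr_id x) -normfV -normrZ -linearZ.
apply: le_supremum => [_ [? _ <-]//||].
  have [M M0 SM] := bop_gt0_bound S; exists M => _ [y /= y1 <-].
  by rewrite (le_trans (SM y))// ler_piMr// ltW.
exists (`|x|^-1 *: x) => //=.
by rewrite normrZ normfV normr_id mulVf ?normr_eq0.
Qed.

Lemma operator_norm_ler (S : L) (M : K) :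
  0 <= M -> (forall x, `|S x| <= M * `|x|) -> operator_norm S <= M.
Proof.
move=> M0 SM; apply: supremum_le => // [_ [? _ <-]//|_ [x /= x1 <-]].
by rewrite (le_trans (SM x))// ler_piMr.
Qed.

Let operator_normD (S U : L) :
  operator_norm (S + U) <= operator_norm S + operator_norm U.
Proof.
apply: operator_norm_ler => [|x]; first by rewrite addr_ge0 ?operator_norm_ge0.
by rewrite bopDE (le_trans (ler_normD _ _))// mulrDl lerD ?ler_operator_norm.
Qed.

Let operator_normZ (a : K) (S : L) :
  operator_norm (a *: S) = `|a| * operator_norm S.
Proof.
have sZ b (U : L) : operator_norm (b *: U) <= `|b| * operator_norm U.
  apply: operator_norm_ler => [|x]; first by rewrite mulr_ge0 ?operator_norm_ge0.
  by rewrite bopZE normrZ -mulrA ler_wpM2l ?ler_operator_norm.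
apply/eqP; rewrite eq_le sZ /=; have [->|a0] := eqVneq a 0.
  by rewrite normr0 mul0r operator_norm_ge0.
rewrite mulrC -ler_pdivlMr ?normr_gt0// mulrC -normfV.
by rewrite -{1}[S](scalerK a0); exact: sZ.
Qed.

Let operator_norm0_eq0 (S : L) : operator_norm S = 0 -> S = 0.
Proof.
move=> S0; apply: bopP => x; apply/eqP; rewrite bop0E -normr_le0.
by have := ler_operator_norm S x; rewrite S0 mul0r.
Qed.

HB.instance Definition _ :=
  Lmodule_isNormed.Build K L operator_normD operator_normZ operator_norm0_eq0.

Lemma bop_normE (S : L) : `|S| = operator_norm S. Proof. by []. Qed.

Lemma ler_bop_norm (S : L) x : `|S x| <= `|S| * `|x|.
Proof. exact: ler_operator_norm. Qed.

End bop_normed.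

Definition nuclear (R : realType) (k : scalar_kind)
    (X Y : normedModType (scalars R k)) : set (bounded_operator X Y) :=
  [set S | exists (xs : nat -> bounded_operator X (scalars R k)^o) (y : nat -> Y),
     cvgn [series `|xs n| * `|y n|]_n /\
     forall x : X, [series xs n x *: y n]_n @ \oo --> S x].

Section sharp.
Context (R : realType) (k : scalar_kind) (Omega : topologicalType).
Context (cOmega : compact [set: Omega]) (E F : normedModType (scalars R k)).
Local Notation K := (scalars R k).
Local Notation CE := (cfun cOmega E).
Local Notation CK := (cfun cOmega K^o).

Lemma tensor_cts (f : CK) (e : E) : continuous (fun w => (f w : K) *: e).
Proof. by move=> w; apply: cvgZr_tmp; exact: cfun_continuous. Qed.

Definition tensor (f : CK) (e : E) : CE := CFun cOmega (@tensor_cts f e).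

Lemma norm_tensor_le (f : CK) (e : E) : `|tensor f e| <= `|f| * `|e|.
Proof.
apply: sup_norm_ler => [|w]; first by rewrite mulr_ge0.
by rewrite /= normrZ ler_wpM2r//; exact: (ler_cfun_norm f w).
Qed.

Lemma tensor_linearl (e : E) : linear (tensor^~ e).
Proof. by move=> a f g; apply: cfunP => w /=; rewrite scalerDl scalerA. Qed.

Lemma tensor_linearr (f : CK) : linear (tensor f).
Proof.
move=> a e e'; apply: cfunP => w /=.
by rewrite scalerDr !scalerA mulrC.
Qed.

Variable T : bounded_operator CE F.

Let sharp_apply_linear (f : CK) : linear (fun e : E => T (tensor f e)).
Proof. by move=> a e e'; rewrite tensor_linearr linearP. Qed.

Let sharp_apply_bounded (f : CK) :
  exists M : K, forall e : E, `|T (tensor f e)| <= M * `|e|.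
Proof.
exists (`|T| * `|f|) => e; rewrite (le_trans (ler_bop_norm T _))//.
by rewrite -mulrA ler_wpM2l// norm_tensor_le.
Qed.

Let sharp_apply (f : CK) : bounded_operator E F :=
  BoundedOperator (sharp_apply_linear f) (sharp_apply_bounded f).

Let sharp_linear : linear sharp_apply.
Proof. by move=> a f g; apply: bopP => e /=; rewrite tensor_linearl linearP. Qed.

Let sharp_bounded : exists M : K, forall f, `|sharp_apply f| <= M * `|f|.
Proof.
exists `|T| => f; apply: operator_norm_ler => [|e /=]; first by rewrite mulr_ge0.
rewrite (le_trans (ler_bop_norm T _))//.
by rewrite -mulrA ler_wpM2l// norm_tensor_le.
Qed.

Definition sharp : bounded_operator CK (bounded_operator E F) :=
  BoundedOperator sharp_linear sharp_bounded.

Lemma sharpE (f : CK) (e : E) : sharp f e = T (tensor f e).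
Proof. by []. Qed.

End sharp.

(* Main.v *)
Require Import Defs.
From mathcomp Require Import all_boot all_order all_algebra.
From mathcomp Require Import all_classical all_reals all_analysis.
Import Order.TTheory GRing.Theory Num.Theory.
Import numFieldNormedType.Exports.
Local Open Scope classical_set_scope.
Local Open Scope ring_scope.

(** A nuclear representation of [T] by pairs [(xs n, y n)] restricts along the
    bounded linear map [tensor f : E -> C(Omega, E)]: since [sharp T f] is the
    composite of [T] with [tensor f], it is represented by the pairs
    [(xs n \o tensor f, y n)].  The functional [xs n \o tensor f] is itself an
    instance of the construction under study, namely [sharp (xs n) f], and its
    norm is at most [`|f| * `|xs n|], so the new series of norms is dominated by
    [`|f|] times the old one.

    The only analytic input is thus the comparison test for nonnegative series.
    Norms take values in the scalar field, which may be complex and is then only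
    partially ordered; [nondecreasing_scalars_is_cvgn] obtains the monotone
    convergence behind that test for both scalar fields at once from the
    existence of suprema of bounded nonnegative sets. *)

(** The limit is the supremum [s] of the values.  In a partially ordered field,
    failing to exceed [s - e] does not in general mean being at most [s - e];
    here it does, because every quantity involved is real. *)
Lemma nondecreasing_scalars_is_cvgn (R : realType) (k : scalar_kind)
    (u : nat -> scalars R k) :
  {homo u : m n / (m <= n)%N >-> m <= n} -> (forall n, 0 <= u n) ->
  has_ubound (range u) -> cvgn u.
Proof.
move=> u_nd u_ge0 u_ub.
have ge0 x : range u x -> 0 <= x by move=> [n _ <-].
have [|us s_least] := supremumsP _ ge0 u_ub; first by exists (u 0%N), 0%N.
set s := supremum 0 _ in us s_least.
have u_le n : u n <= s by apply: us; exists n.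
have s_real : s \is Num.real by rewrite ger0_real// (le_trans (u_ge0 0%N)).
apply/cvg_ex; exists s; apply/cvgrPdist_lt => e e0.
have [N uN] : exists N, s - e < u N.
  apply: contrapT => noN.
  have se_real : s - e \is Num.real by rewrite rpredB// gtr0_real.
  have : s <= s - e.
    apply: s_least => _ [n _ <-]; rewrite real_leNgt ?(ger0_real (u_ge0 n))//.
    by apply/negP => ?; apply: noN; exists n.
  by apply/negP; rewrite -real_ltNge// ltrBlDr ltrDl.
near=> n; rewrite ger0_norm ?subr_ge0// ltrBlDr -ltrBlDl.
by rewrite (lt_le_trans uN)// u_nd//; near: n; exact: nbhs_infty_ge.
Unshelve. all: by end_near. Qed.

Lemma scalars_series_le_cvgn (R : realType) (k : scalar_kind)
    (a b : nat -> scalars R k) :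
  (forall n, 0 <= a n) -> (forall n, a n <= b n) ->
  cvgn (series b) -> cvgn (series a).
Proof.
move=> a_ge0 ab /cvg_seq_bounded [M [_ bM]].
have /bM {}bM : M < M + 1 by rewrite ltrDl.
have b_ge0 n : 0 <= b n by exact: le_trans (ab n).
apply: nondecreasing_scalars_is_cvgn => [m n mn|n|].
- by rewrite -subr_ge0 sub_series mn sumr_ge0.
- by rewrite /series/= sumr_ge0.
- exists (M + 1) => _ [n _ <-]; apply: le_trans (bM n I).
  by rewrite ger0_norm ?sumr_ge0//= /series/= ler_sum.
Qed.

Lemma norm_sharp_le (R : realType) (k : scalar_kind) (Omega : topologicalType)
    (cOmega : compact [set: Omega]) (E F : normedModType (scalars R k))
    (T : bounded_operator (cfun cOmega E) F)
    (f : cfun cOmega (scalars R k)^o) :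
  `|sharp T f| <= `|f| * `|T|.
Proof.
apply: operator_norm_ler => [|e]; first by rewrite mulr_ge0.
rewrite sharpE (le_trans (ler_bop_norm T _))// [`|f| * _]mulrC -mulrA ler_wpM2l//.
exact: norm_tensor_le.
Qed.

Theorem theorem3 (R : realType) (k : scalar_kind)
    (Omega : topologicalType) (cOmega : compact [set: Omega])
    (hOmega : hausdorff_space Omega)
    (E F : completeNormedModType (scalars R k))
    (T : bounded_operator (cfun cOmega E) F) (nT : nuclear T) :
  forall f : cfun cOmega (scalars R k)^o, nuclear (sharp T f).
Proof.
move=> f; have [xs [y [cvg_norms TE]]] := nT.
exists (fun n => sharp (xs n) f), y; split => [|e]; last exact: TE (tensor f e).
apply: (@scalars_series_le_cvgn _ _ _ (fun n => `|f| * (`|xs n| * `|y n|))).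
- by move=> n; rewrite mulr_ge0.
- by move=> n; rewrite mulrA ler_wpM2r// norm_sharp_le.
- exact: is_cvg_seriesZ cvg_norms.
Qed.
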